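(* Let $k$ be a positive integer and $n\ge k-3$. Nonnegative integers $a\le b\le c$ are the cardinalities of the Venn regions, other than the isolated point set, of some cap $S\subseteq\mathbb{F}_2^n$ with $|S|=k$ and $\dim S=k-3$ if and only if (1) $a+b+c\le k$; (2) $a$, $b$, $c$ all have the same parity; (3) $a+b\ge 6$.
   Context: The dimension of $S$ is that of its affine span. A cap is a subset of $\mathbb{F}_2^n$ containing no four distinct elements summing to $\vec 0$. $E(S)$ is the $\mathbb{F}_2$-subspace (under symmetric difference) of $\mathcal{P}(S)$ consisting of even-size subsets of $S$ whose elements sum to $\vec 0$ (including $\varnothing$); when $|S|=k$ and $\dim S=k-3$, $\dim E(S)=2$. For a basis $(X_1,X_2)$ of $E(S)$ the Venn regions are $X_1\cap X_2$, $X_1\setminus X_2$, $X_2\setminus X_1$ and the isolated point set $S\setminus(X_1\cup X_2)$. *)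

(* Defs.v *)
From HB Require Import structures.
From mathcomp Require Import all_boot all_order all_algebra.

Set Implicit Arguments.
Unset Strict Implicit.
Unset Printing Implicit Defensive.

Import GRing.Theory.
Local Open Scope ring_scope.

(* The power set of T as a vector space over F_2, addition being the symmetric
   difference.  This is an alias so that {set T} itself carries no additive
   structure. *)
Definition symset (T : finType) : Type := {set T}.

Section SymsetVector.
Variable T : finType.
Implicit Types (A B C : {set T}) (a b : 'F_2).

HB.instance Definition _ := Finite.copy (symset T) {set T}.

Definition symdiff A B : symset T := (A :\: B) :|: (B :\: A).

Lemma in_symdiff A B x : (x \in symdiff A B) = (x \in A) (+) (x \in B).
Proof. by rewrite !inE; do 2!case: (x \in _). Qed.

Fact symdiffA : associative (symdiff : symset T -> symset T -> symset T).
Proof. by move=> A B C; apply/setP=> x; rewrite !in_symdiff addbA. Qed.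

Fact symdiffC : commutative (symdiff : symset T -> symset T -> symset T).
Proof. by move=> A B; apply/setP=> x; rewrite !in_symdiff addbC. Qed.

Fact symdiff0s : left_id (set0 : symset T) symdiff.
Proof. by move=> A; apply/setP=> x; rewrite in_symdiff inE. Qed.

Fact symdiffss : left_inverse (set0 : symset T) id symdiff.
Proof. by move=> A; apply/setP=> x; rewrite in_symdiff addbb inE. Qed.

HB.instance Definition _ :=
  GRing.isZmodule.Build (symset T) symdiffA symdiffC symdiff0s symdiffss.

Definition symscale a (A : symset T) : symset T := if a == 0 then set0 else A.

Lemma F2_cases a : (a = 0) + (a = 1).
Proof.
by case: a => [[|[|//]] lt_a]; [left | right]; apply: val_inj.
Qed.

Fact symscaleA a b (A : symset T) :
  symscale a (symscale b A) = symscale (a * b) A.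
Proof. by case: (F2_cases a) (F2_cases b) => -> [] ->. Qed.

Fact symscale1 : left_id 1 symscale.
Proof. by []. Qed.

Fact symscaleDr : right_distributive symscale +%R.
Proof. by move=> a A B; case: (F2_cases a) => -> //; rewrite /symscale addr0. Qed.

Fact symscaleDl (A : symset T) : {morph symscale^~ A : a b / a + b}.
Proof.
move=> a b; case: (F2_cases a) (F2_cases b) => -> [] ->; rewrite /symscale /=.
- by rewrite addr0.
- by rewrite add0r.
- by rewrite addr0.
- exact: esym (symdiffss A).
Qed.

HB.instance Definition _ := GRing.Zmodule_isLmodule.Build 'F_2 (symset T)
  symscaleA symscale1 symscaleDr symscaleDl.

Lemma in_symsetD (A B : symset T) x :
  (x \in (A + B : {set T})) = (x \in (A : {set T})) (+) (x \in (B : {set T})).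
Proof. exact: in_symdiff. Qed.

Lemma in_symsetZ a (A : symset T) x :
  (x \in (a *: A : {set T})) = (a != 0) && (x \in (A : {set T})).
Proof. by case: (F2_cases a) => ->; rewrite // [LHS]inE. Qed.

Lemma natr_F2_addb (p q : bool) : (p (+) q)%:R = p%:R + q%:R :> 'F_2.
Proof. by case: p; case: q; apply: val_inj. Qed.

Fact symset_vect_iso : Vector.axiom #|T| (symset T).
Proof.
pose f (A : symset T) : 'rV['F_2]_#|T| :=
  \row_i (enum_val i \in (A : {set T}))%:R.
exists f => [a A B|].
  apply/rowP=> i; rewrite !mxE in_symsetD in_symsetZ natr_F2_addb.
  by case: (F2_cases a) => ->; rewrite ?mul0r ?mul1r.
exists (fun v : 'rV_#|T| => [set x | v 0 (enum_rank x) != 0] : symset T).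
  move=> A; apply/setP=> x; rewrite inE mxE enum_rankK.
  by case: (x \in _).
move=> v; apply/rowP=> i; rewrite mxE inE enum_valK.
by case: (F2_cases (v 0 i)) => ->.
Qed.

HB.instance Definition _ :=
  Lmodule_hasFinDim.Build 'F_2 (symset T) symset_vect_iso.

End SymsetVector.

Section Caps.
Variable n : nat.
Local Notation V := 'rV['F_2]_n.
Implicit Types (S : {set V}).

Definition affine_span S : {set V} :=
  [set \sum_(x in S) l x *: x
     | l : {ffun V -> 'F_2} & \sum_(x in S) l x == 1].

(* Dimension of the translation space of the affine span.  The value is 0 on
   the empty set. *)
Definition affine_dim S : nat :=
  \dim << [seq x - y | x <- enum (affine_span S), y <- enum (affine_span S)] >>.

Definition is_cap S : Prop :=
  forall x y z w : V, x \in S -> y \in S -> z \in S -> w \in S ->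
    uniq [:: x; y; z; w] -> x + y + z + w != 0.

Definition even_zero_sum S : {set symset V} :=
  [set X : symset V | [&& (X : {set V}) \subset S, ~~ odd #|(X : {set V})|
                        & \sum_(x in (X : {set V})) x == 0]].

(* The span adds no new element: see memE below. *)
Definition E S : {vspace symset V} := <<enum (even_zero_sum S)>>%VS.

Lemma even_zero_sumP S (X : symset V) :
  X \in even_zero_sum S =
  [&& (X : {set V}) \subset S,
      \sum_x (x \in (X : {set V}))%:R == 0 :> 'F_2
    & \sum_x (x \in (X : {set V}))%:R *: x == 0 :> V].
Proof.
rewrite inE; congr [&& _, _ & _].
  have ->: \sum_x (x \in (X : {set V}))%:R = #|(X : {set V})|%:R :> 'F_2.
    rewrite -sum1_card natr_sum [RHS]big_mkcond /=.
    by apply: eq_bigr => x _; case: ifP.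
  by rewrite -[RHS](inj_eq val_inj) /= val_Fp_nat // modn2; case: odd.
congr (_ == _); rewrite big_mkcond /=; apply: eq_bigr => x _.
by case: ifP; rewrite ?scale1r ?scale0r.
Qed.

Lemma even_zero_sumD S (X Y : symset V) :
  X \in even_zero_sum S -> Y \in even_zero_sum S -> X + Y \in even_zero_sum S.
Proof.
rewrite !even_zero_sumP.
move=> /and3P[sXS /eqP X1 /eqP X2] /and3P[sYS /eqP Y1 /eqP Y2].
apply/and3P; split.
- apply/subsetP=> x; rewrite in_symsetD.
  case: (boolP (x \in (X : {set V}))) => [/(subsetP sXS)-> //|_] /=.
  exact: (subsetP sYS).
- rewrite (eq_bigr (fun x => (x \in (X : {set V}))%:R
                             + (x \in (Y : {set V}))%:R)).
    by rewrite big_split /= X1 Y1 addr0.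
  by move=> x _; rewrite in_symsetD natr_F2_addb.
- rewrite (eq_bigr (fun x => (x \in (X : {set V}))%:R *: x
                             + (x \in (Y : {set V}))%:R *: x)).
    by rewrite big_split /= X2 Y2 addr0.
  by move=> x _; rewrite in_symsetD natr_F2_addb scalerDl.
Qed.

Lemma even_zero_sum0 S : (0 : symset V) \in even_zero_sum S.
Proof. by rewrite inE sub0set cards0 big_set0 /=. Qed.

Lemma memE S (X : symset V) :
  X \in E S = [&& (X : {set V}) \subset S, ~~ odd #|(X : {set V})|
                & \sum_(x in (X : {set V})) x == 0].
Proof.
transitivity (X \in even_zero_sum S); last by rewrite inE.
apply/idP/idP=> [XE | XE]; last by rewrite memv_span // mem_enum.
rewrite (coord_span (X := in_tuple _) XE).
apply: (big_ind (fun Y => Y \in even_zero_sum S)) => [|Y Z|i _].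
- exact: even_zero_sum0.
- exact: even_zero_sumD.
- have Xi : (in_tuple (enum (even_zero_sum S)))`_i \in even_zero_sum S.
    by rewrite -mem_enum mem_nth.
  set c := coord _ _ _; case: (F2_cases c) => ->; rewrite ?scale1r //.
  by rewrite scale0r even_zero_sum0.
Qed.

Definition venn_sizes (X1 X2 : {set V}) : seq nat :=
  [:: #|X1 :&: X2|; #|X1 :\: X2|; #|X2 :\: X1|].

End Caps.

(* Main.v *)
(* Relations in E(S) have even size, and in a cap they have neither size 2 nor
   size 4; so every nonzero one has size at least 6, and the sums of two of
   a, b, c are the sizes of X1, X2 and X1 + X2.  Conversely, take k - 2 affinely
   independent points v_i and odd sets of indices P, Q with |P :&: Q| = a,
   |P :\: Q| = b - 1, |Q :\: P| = c - 1, and add the points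
   x = sum_P v_i and y = sum_Q v_i.  Then X1 = x |: v(P) and X2 = y |: v(Q) lie
   in E(S), and subtracting them from a relation removes x and y from it, which
   leaves a relation between the v_i, i.e. the empty one. *)
Require Import Defs.
From mathcomp Require Import all_boot all_order all_algebra.
From mathcomp Require Import zify.

Set Implicit Arguments.
Unset Strict Implicit.
Unset Printing Implicit Defensive.

Import GRing.Theory.
Local Open Scope ring_scope.

(** * Characteristic two and subsets of prescribed sizes *)

Lemma addrr_F2 (V : lmodType 'F_2) (x : V) : x + x = 0.
Proof.
rewrite -[x]scale1r -scalerDl (_ : 1 + 1 = 0 :> 'F_2) ?scale0r //.
exact: val_inj.
Qed.

Lemma addr_eq0_F2 (V : lmodType 'F_2) (x y : V) : (x + y == 0) = (x == y).
Proof. by rewrite -[0](addrr_F2 y) (inj_eq (addIr y)). Qed.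

Lemma exists_subset_card (T : finType) (A : {set T}) (p : nat) :
  (p <= #|A|)%N -> exists2 B : {set T}, B \subset A & #|B| = p.
Proof.
case/card_geqP=> s [us <- sA]; exists [set x in s].
  by apply/subsetP=> x; rewrite inE => /sA.
by rewrite cardsE (card_uniqP us).
Qed.

(** [P] and [Q] are [A :|: B] and [A :|: C] for disjoint [A], [B], [C] of sizes [p], [q], [r], each
    picked in the complement of the earlier ones. *)
Lemma exists_sets_venn_sizes (T : finType) (p q r : nat) : (p + q + r <= #|T|)%N ->
  exists P Q : {set T},
    [/\ #|P :&: Q| = p, #|P :\: Q| = q & #|Q :\: P| = r].
Proof.
move=> le_pqr.
have [|A _ cA] := @exists_subset_card _ [set: T] p; first by rewrite cardsT; lia.
have cA' := cardsC A.
have [|B sB cB] := @exists_subset_card _ (~: A) q; first by lia.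
have dAB : [disjoint A & B] by rewrite disjoint_sym disjoints_subset.
have cAB : #|A :|: B| = (p + q)%N.
  by rewrite cardsU (disjoint_setI0 dAB) cards0 subn0 cA cB.
have cAB' := cardsC (A :|: B).
have [|C sC cC] := @exists_subset_card _ (~: (A :|: B)) r; first by lia.
have AB x : x \in B -> x \notin A by move/(subsetP sB); rewrite inE.
have ABC x : x \in C -> (x \notin A) && (x \notin B).
  by move/(subsetP sC); rewrite !inE negb_or.
exists (A :|: B), (A :|: C); rewrite -{1}cA -{}cB -{}cC.
split; apply: eq_card => x; rewrite !inE;
  by move: (AB x) (ABC x); do 3!case: (x \in _) => //=; do ?[move/(_ isT)];
     move=> // _ /(_ isT).
Qed.

(** * Sizes of relations in a cap *)

Section Relations.
Variable n : nat.
Local Notation V := 'rV['F_2]_n.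
Implicit Types (S : {set V}) (X Y : symset V).

(** Parity leaves sizes 2 and 4 to exclude: two points with zero sum coincide, and four distinct
    ones contradict the cap condition. *)
Lemma E_card_ge6 S X :
  is_cap S -> X \in E S -> X != 0 -> (6 <= #|(X : {set V})|)%N.
Proof.
move=> capS; rewrite Defs.memE => /and3P[sXS evX sumX] X_neq0.
have : #|(X : {set V})| != 0%N by rewrite cards_eq0.
rewrite leqNgt; apply: contraNN => lt6.
have big_enum_X : \sum_(x <- enum (X : {set V})) x == 0 :> V.
  by rewrite big_enum.
have XS x : x \in enum (X : {set V}) -> x \in S.
  by rewrite mem_enum => /(subsetP sXS).
have := enum_uniq (X : {set V}).
move: evX lt6 big_enum_X XS; rewrite cardE.
case: (enum _) => [|x [|y [|z [|w [|? [|? ?]]]]]] //= _ _.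
  rewrite !big_cons big_nil addr0 addr_eq0_F2 => /eqP-> _.
  by rewrite inE eqxx.
rewrite !big_cons big_nil addr0 !addrA => /eqP sum0 XS uX.
have := capS x y z w; rewrite !XS ?inE ?eqxx ?orbT //.
by move=> /(_ isT isT isT isT uX); rewrite sum0 eqxx.
Qed.

Lemma card_symsetD X Y :
  #|(X + Y : symset V) : {set V}| = (#|X :\: Y| + #|Y :\: X|)%N.
Proof.
rewrite [X + Y]/(symdiff X Y) cardsU (_ : _ :&: _ = set0) ?cards0 ?subn0 //.
by apply/setP=> x; rewrite !inE; do 2!case: (x \in _).
Qed.

Lemma venn_sizes_cap S X1 X2 p q r :
  is_cap S -> basis_of (E S) [:: X1; X2] -> venn_sizes X1 X2 = [:: p; q; r] ->
  [/\ (p + q + r <= #|S|)%N, odd p = odd q /\ odd q = odd r,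
      (6 <= p + q)%N, (6 <= p + r)%N & (6 <= q + r)%N].
Proof.
move=> capS basisE [cI c1 c2].
have X1E : X1 \in E S by apply: (basis_mem basisE); rewrite !inE eqxx.
have X2E : X2 \in E S by apply: (basis_mem basisE); rewrite !inE eqxx orbT.
(* [X1] is off the line spanned by [X2], which contains 0 and [X2]; so [X1] and [X1 + X2] are
   nonzero. *)
have [X12_neq0 X1_neq0 X2_neq0] : [/\ X1 + X2 != 0, X1 != 0 & X2 != 0].
  have /[dup] freeX := basis_free basisE.
  rewrite free_cons !span_seq1 seq1_free => /andP[X1_X2 ->].
  split=> //; last by apply: contraNneq X1_X2 => ->; rewrite mem0v.
  by rewrite addr_eq0_F2; apply: contraNneq X1_X2 => ->; rewrite memv_line.
have cD := card_symsetD X1 X2.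
have cX1 := cardsID X2 X1; have cX2 := cardsID X1 X2; rewrite setIC in cX2.
have := E_card_ge6 capS (memvD X1E X2E) X12_neq0.
have := E_card_ge6 capS X1E X1_neq0; have := E_card_ge6 capS X2E X2_neq0.
move: (X1E) (X2E); rewrite !Defs.memE.
move=> /and3P[s1 o1 _] /and3P[s2 o2 _].
have : (#|X1 :|: X2| <= #|S|)%N by rewrite subset_leq_card // subUset s1 s2.
(* Inclusion-exclusion gives the union size [p + q + r]; the parities agree because [p + q] and
   [p + r] are even. *)
rewrite cardsU; move: o1 o2; rewrite cD -cX1 -cX2 c1 c2 cI !oddD.
move=> o1 o2 le_k g2 g1 g3; split=> //; first by clear -le_k; lia.
by move: o1 o2; do 3!case: (odd _).
Qed.

End Relations.

(** * A cap with prescribed Venn regions *)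

Section Construction.
Variables (n d : nat) (e : d.-tuple 'rV['F_2]_n) (P Q : {set 'I_d.+1}).
Local Notation V := 'rV['F_2]_n.
Hypothesis free_e : free e.
Hypotheses (oddP : odd #|P|) (oddQ : odd #|Q|).
(** Adjoining [x] and [y] adds one to each size, so these bounds make [X1], [X2] and [X1 + X2] have
    at least 6 elements. *)
Hypotheses (card_P_ge5 : (5 <= #|P|)%N) (card_Q_ge5 : (5 <= #|Q|)%N).
Hypothesis card_PDQ_ge4 : (4 <= #|P :\: Q| + #|Q :\: P|)%N.

(* The origin together with the vectors of e: d + 1 affinely independent points. *)
Let v (i : 'I_d.+1) : V := (0 :: e : seq V)`_i.

(** As [v] vanishes at index 0, freeness of [e] recovers membership of every other index from the
    sum; parity then settles index 0. *)
Lemma affine_free (A B : {set 'I_d.+1}) :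
  odd #|A| = odd #|B| -> \sum_(i in A) v i = \sum_(i in B) v i -> A = B.
Proof.
have sumE (C : {set 'I_d.+1}) :
    \sum_(i in C) v i = \sum_(j < d) (lift ord0 j \in C)%:R *: e`_j.
  rewrite big_mkcond big_ord_recl /v /= if_same add0r.
  by apply: eq_bigr => j _; case: ifP; rewrite ?scale1r ?scale0r.
have cardE (C : {set 'I_d.+1}) :
    #|C| = ((ord0 \in C) + \sum_(j < d) (lift ord0 j \in C))%N.
  rewrite -sum1_card big_mkcond big_ord_recl /=.
  by congr (_ + _)%N; apply: eq_bigr => j _; case: (_ \in _).
move=> odd_eq; rewrite !sumE => /eqP; rewrite -subr_eq0 -sumrB => /eqP sum0.
have liftE j : (lift ord0 j \in A) = (lift ord0 j \in B).
  have /freeP/(_ (fun j => (lift ord0 j \in A)%:R - (lift ord0 j \in B)%:R)) :=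
    free_e.
  move=> /(_ _ j) /= coef0.
  have : (lift ord0 j \in A)%:R - (lift ord0 j \in B)%:R = 0 :> 'F_2.
    apply: coef0; rewrite -[RHS]sum0; apply: eq_bigr => i _.
    by rewrite scalerBl.
  by do 2!case: (_ \in _).
apply/setP=> i; case: (unliftP ord0 i) => [j ->|->]; first exact: liftE.
move: odd_eq; rewrite !cardE.
rewrite (eq_bigr _ (fun j _ => congr1 nat_of_bool (liftE j))).
by rewrite !oddD => /addIb; do 2!case: (_ \in _).
Qed.

Lemma v_inj : injective v.
Proof.
move=> i j eq_v; apply: set1_inj; apply: affine_free; rewrite ?cards1 //.
by rewrite !big_set1.
Qed.

Let x := \sum_(i in P) v i.
Let y := \sum_(i in Q) v i.

(** An odd [C] with sum [v i] would be the singleton of [i], against its size. *)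
Lemma sum_notin_v (C : {set 'I_d.+1}) i :
  odd #|C| -> (5 <= #|C|)%N -> \sum_(i in C) v i != v i.
Proof.
move=> oddC C5; apply/eqP=> sumC.
suff C1 : C = [set i] by rewrite C1 cards1 in C5.
by apply: affine_free; rewrite ?cards1 ?big_set1.
Qed.

Lemma x_notin (C : {set 'I_d.+1}) : x \notin v @: C.
Proof. by apply/imsetP=> -[i _ /eqP]; rewrite (negPf (sum_notin_v _ _ _)). Qed.

Lemma y_notin (C : {set 'I_d.+1}) : y \notin v @: C.
Proof. by apply/imsetP=> -[i _ /eqP]; rewrite (negPf (sum_notin_v _ _ _)). Qed.

Lemma x_neq_y : x != y.
Proof.
apply/eqP=> eq_xy; move: card_PDQ_ge4.
by rewrite (affine_free _ eq_xy) ?oddP ?oddQ // setDv cards0.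
Qed.

Definition cap_points : {set V} := x |: (y |: v @: [set: 'I_d.+1]).
Local Notation S := cap_points.
Definition cap_rel1 : symset V := x |: v @: P.
Definition cap_rel2 : symset V := y |: v @: Q.
Local Notation X1 := cap_rel1.
Local Notation X2 := cap_rel2.

(** [x] lies in [X1] only and [y] in [X2] only, so these points detect the coefficients of a
    combination of [X1] and [X2]. *)
Let x_notin_X2 : x \notin (X2 : {set V}).
Proof. by rewrite !inE negb_or x_neq_y x_notin. Qed.

Let y_notin_X1 : y \notin (X1 : {set V}).
Proof. by rewrite !inE negb_or eq_sym x_neq_y y_notin. Qed.

Let x_in_X1 : x \in (X1 : {set V}).
Proof. exact: setU11. Qed.

Let y_in_X2 : y \in (X2 : {set V}).
Proof. exact: setU11. Qed.

Lemma card_cap_points : #|S| = d.+3.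
Proof.
rewrite !cardsU1 !inE negb_or x_neq_y x_notin y_notin.
by rewrite card_imset ?cardsT ?card_ord //; apply: v_inj.
Qed.

Lemma cap_rel1_in : X1 \in E S.
Proof.
rewrite Defs.memE setUS ?cardsU1 ?x_notin /=; last first.
  by rewrite subsetU // imsetS ?subsetT ?orbT.
rewrite card_imset ?oddP //=; last exact: v_inj.
rewrite big_setU1 ?x_notin //= big_imset ?addrr_F2 //.
by move=> i j _ _; apply: v_inj.
Qed.

Lemma cap_rel2_in : X2 \in E S.
Proof.
rewrite Defs.memE cardsU1 y_notin /= subsetU ?setUS ?imsetS ?subsetT ?orbT //=.
rewrite card_imset ?oddQ //=; last exact: v_inj.
rewrite big_setU1 ?y_notin //= big_imset ?addrr_F2 //.
by move=> i j _ _; apply: v_inj.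
Qed.

(** Such a relation is the image of an index set of even size with zero sum, which [affine_free]
    compares with the empty set. *)
Lemma rel_avoiding_eq0 (X : symset V) :
  X \in E S -> x \notin (X : {set V}) -> y \notin (X : {set V}) -> X = 0.
Proof.
rewrite Defs.memE => /and3P[sXS evX /eqP sumX] xX yX.
have X_im : X = v @: (v @^-1: X) :> {set V}.
  apply/setP=> z; apply/idP/imsetP=> [zX|[i]]; last by rewrite inE => ? ->.
  have := subsetP sXS z zX; rewrite !inE.
  case: eqP => [zx|_]; first by rewrite zx (negPf xX) in zX.
  case: eqP => [zy|_]; first by rewrite zy (negPf yX) in zX.
  by case/imsetP=> i _ zv; exists i; rewrite ?inE -?zv.
rewrite X_im (_ : _ @^-1: _ = set0) ?imset0 //; apply: affine_free.
  by rewrite cards0 -(card_imset _ v_inj) -X_im (negPf evX).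
rewrite big_set0; apply: etrans sumX; rewrite [in RHS]X_im big_imset //.
by move=> i j _ _; apply: v_inj.
Qed.

Lemma cap_rel_decomp (X : symset V) : X \in E S ->
  X = (x \in (X : {set V}))%:R *: X1 + (y \in (X : {set V}))%:R *: X2.
Proof.
move=> XE; set Z := _ + _; apply/eqP; rewrite -addr_eq0_F2; apply/eqP.
have natrF2_neq0 (b : bool) : (b%:R != 0 :> 'F_2) = b by case: b.
apply: rel_avoiding_eq0.
- by rewrite !memvD ?memvZ ?cap_rel1_in ?cap_rel2_in.
- rewrite !in_symsetD !in_symsetZ !natrF2_neq0 (negPf x_notin_X2) x_in_X1.
  by rewrite andbF andbT addbF addbb.
- rewrite !in_symsetD !in_symsetZ !natrF2_neq0 (negPf y_notin_X1) y_in_X2.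
  by rewrite andbF andbT addbb.
Qed.

Lemma cap_rel_basis : basis_of (E S) [:: X1; X2].
Proof.
rewrite basisEfree; apply/and3P; split.
- rewrite free_cons seq1_free span_seq1; apply/andP; split.
    apply/vlineP=> -[z X1E]; have := x_in_X1.
    by rewrite X1E in_symsetZ (negPf x_notin_X2) andbF.
  by apply/eqP=> X20; have := y_in_X2; rewrite X20 inE.
- by apply/span_subvP=> X; rewrite !inE => /orP[]/eqP->;
    rewrite ?cap_rel1_in ?cap_rel2_in.
(* The decomposition bounds the dimension of [E S] by 2. *)
- apply: (@leq_trans (\dim <<[:: X1; X2]>>)); last exact: dim_span.
  apply/dimvS/subvP=> X XE; rewrite (cap_rel_decomp XE).
  by rewrite memvD ?memvZ ?memv_span ?inE ?eqxx ?orbT.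
Qed.

Lemma card_cap_rel1 : #|X1| = #|P|.+1.
Proof. by rewrite cardsU1 x_notin card_imset //; apply: v_inj. Qed.

Lemma card_cap_rel2 : #|X2| = #|Q|.+1.
Proof. by rewrite cardsU1 y_notin card_imset //; apply: v_inj. Qed.

(** Each of [x] and [y] belongs to a single relation, so the intersection keeps its size and each
    difference grows by one. *)
Lemma venn_cap_rels :
  venn_sizes X1 X2 = [:: #|P :&: Q|; #|P :\: Q|.+1; #|Q :\: P|.+1].
Proof.
have cI : #|X1 :&: X2| = #|P :&: Q|.
  rewrite -(card_imset _ v_inj) imsetI; last by move=> i j _ _; apply: v_inj.
  apply: eq_card => z; rewrite !inE.
  case: (z =P x) => [->|_]; first by rewrite (negPf x_neq_y) !(negPf (x_notin _)).
  by case: (z =P y) => [->|_]; rewrite // !(negPf (y_notin _)).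
have cP := cardsID Q P; have cQ := cardsID P Q; rewrite setIC in cQ.
have cX1 := cardsID X2 X1; have cX2 := cardsID X1 X2; rewrite setIC in cX2.
rewrite /venn_sizes cI; congr [:: _; _; _].
  by apply/eqP; rewrite -(eqn_add2l #|P :&: Q|) -{1}cI cX1 addnS cP card_cap_rel1.
by apply/eqP; rewrite -(eqn_add2l #|P :&: Q|) -{1}cI cX2 addnS cQ card_cap_rel2.
Qed.

(** Four distinct points with zero sum would form one of 0, [X1], [X2], [X1 + X2], whose sizes are 0
    or at least 6. *)
Lemma cap_points_cap : is_cap S.
Proof.
move=> p q r s pS qS rS sS uniq4; apply/eqP=> sum0.
pose X : symset V := [set z in [:: p; q; r; s]].
have cX : #|(X : {set V})| = 4 by rewrite cardsE (card_uniqP uniq4).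
have XE : X \in E S.
  rewrite Defs.memE cX /=; apply/andP; split.
    apply/subsetP=> z; rewrite in_set; move: z; apply/allP.
    by rewrite /= pS qS rS sS.
  have sum4 : \sum_(z <- [:: p; q; r; s]) z = 0.
    by rewrite !big_cons big_nil addr0 !addrA.
  apply/eqP; apply: etrans sum4; rewrite big_uniq //.
  by apply: eq_bigl => z; rewrite inE.
have [_ c1 c2] := venn_cap_rels.
move: cX; rewrite (cap_rel_decomp XE).
case: (_ \in _); case: (_ \in _); rewrite ?scale1r ?scale0r ?add0r ?addr0.
- rewrite card_symsetD c1 c2 addSn addnS => -[card2].
  by move: card_PDQ_ge4; rewrite card2.
- by rewrite card_cap_rel1 => -[card3]; move: card_P_ge5; rewrite card3.
- by rewrite card_cap_rel2 => -[card3]; move: card_Q_ge5; rewrite card3.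
- by rewrite cards0.
Qed.

(** All points, hence their affine combinations, lie in the span of [e]; conversely each vector of
    [e] is its own difference with the origin, a point of [S]. *)
Lemma affine_dim_cap_points : affine_dim S = d.
Proof.
have v_mem i : v i \in <<e>>%VS.
  rewrite /v; case: (unliftP ord0 i) => [j ->|->] /=; last exact: mem0v.
  rewrite add0n; apply: memv_span; apply: mem_nth.
  by rewrite size_tuple; apply: ltn_ord.
have sSe z : z \in S -> z \in <<e>>%VS.
  rewrite !inE => /or3P[/eqP->|/eqP->|/imsetP[i _ ->]] //;
  by apply: memv_suml => i _; apply: v_mem.
have sS_span z : z \in S -> z \in affine_span S.
  (* The affine combination with coefficient 1 at [z] and 0 elsewhere. *)
  move=> zS; apply/imsetP; exists [ffun t => (t == z)%:R].
    rewrite inE (bigD1 z) //= ffunE eqxx big1 ?addr0 // => t /andP[_ /negPf tz].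
    by rewrite ffunE tz.
  rewrite (bigD1 z) //= ffunE eqxx scale1r big1 ?addr0 // => t /andP[_ /negPf tz].
  by rewrite ffunE tz scale0r.
have span_e z : z \in affine_span S -> z \in <<e>>%VS.
  by case/imsetP=> l _ ->; apply: memv_suml => t /sSe tS; apply: memvZ.
have vS i : v i \in S by rewrite !inE imset_f ?orbT.
rewrite /affine_dim -[RHS](size_tuple e) -(eqP free_e); congr (\dim _).
apply/eqP; rewrite eqEsubv; apply/andP; split; apply/span_subvP=> z.
  case/allpairsP=> -[s t] /= [sA tA ->]; rewrite !mem_enum in sA tA.
  by rewrite memvB ?span_e.
case/(nthP 0) => j; rewrite size_tuple => lt_jd <-.
apply: memv_span; apply/allpairsP.
exists (v (lift ord0 (Ordinal lt_jd)), v ord0) => /=.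
by rewrite !mem_enum !sS_span ?subr0.
Qed.

End Construction.

(** * Free families and the equivalence *)

Lemma exists_free_tuple n d : (d <= n)%N ->
  exists e : d.-tuple 'rV['F_2]_n, free e.
Proof.
move=> le_dn; pose b := vbasis {: 'rV['F_2]_n}.
have size_d : size (take d b) == d.
  by rewrite size_takel // size_tuple dimvf /dim /= mul1n.
exists (Tuple size_d) => /=; apply: (@catl_free _ _ (drop d b)).
by rewrite cat_take_drop; apply: basis_free (vbasisP _).
Qed.

Theorem theorem6p3 (k n a b c : nat) (k_gt0 : (0 < k)%N)
    (le_k_n : (k <= n + 3)%N) (le_ab : (a <= b)%N) (le_bc : (b <= c)%N) :
  (exists S : {set 'rV['F_2]_n},
     [/\ is_cap S,
         #|S| = k,
         (affine_dim S + 3)%N = k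
       & exists X1 X2 : symset 'rV['F_2]_n,
           basis_of (E S) [:: X1; X2]
           /\ perm_eq (venn_sizes X1 X2) [:: a; b; c]])
  <->
  [/\ (a + b + c <= k)%N,
      odd a = odd b /\ odd b = odd c
    & (6 <= a + b)%N].
Proof.
split=> [[S [capS <- _ [X1 [X2 [basisE]]]]]|[le_abc_k [odd_ab odd_bc] ab_ge6]].
  case defv: (venn_sizes X1 X2) => [|p [|q [|r []]]] //.
  have [le_k [o1 o2] g1 g2 g3] := venn_sizes_cap capS basisE defv.
  move=> /[dup] /perm_sumn /= sumE /perm_mem mem_abc.
  have : a \in [:: p; q; r] by rewrite mem_abc !inE eqxx.
  have : b \in [:: p; q; r] by rewrite mem_abc !inE eqxx ?orbT.
  have : c \in [:: p; q; r] by rewrite mem_abc !inE eqxx ?orbT.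
  rewrite !inE => cE bE aE.
  have oE z : [|| z == p, z == q | z == r] -> odd z = odd p.
    by case/or3P=> /eqP->; rewrite ?o1 ?o2.
  rewrite !addnA !addn0 in sumE; split; first by rewrite -sumE.
    by rewrite !oE.
  (* Since [c] is one of [p], [q], [r], the sum [a + b] is that of the other two. *)
  by clear -g1 g2 g3 sumE cE; case/or3P: cE => /eqP cE; lia.
(* From [a <= b] and [6 <= a + b] follows [3 <= b <= c], so no subtraction here truncates; [x] and
   [y] restore the ones taken from [b] and [c]. *)
have [|P [Q [cI c1 c2]]] := @exists_sets_venn_sizes 'I_(k - 3).+1 a b.-1 c.-1.
  by rewrite card_ord; lia.
have cP := cardsID Q P; have cQ := cardsID P Q; rewrite setIC in cQ.
have [|e free_e] := @exists_free_tuple n (k - 3); first by lia.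
have oddP : odd #|P| by lia.
have oddQ : odd #|Q| by lia.
have [cP5 cQ5 cD4] :
  [/\ 5 <= #|P|, 5 <= #|Q| & 4 <= #|P :\: Q| + #|Q :\: P|]%N by split; lia.
exists (cap_points e P Q); split.
- exact: cap_points_cap.
- by rewrite card_cap_points //; lia.
- by rewrite affine_dim_cap_points //; lia.
- exists (cap_rel1 e P), (cap_rel2 e Q); split; first exact: cap_rel_basis.
  rewrite venn_cap_rels // cI c1 c2 !prednK //; lia.
Qed.
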